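(* Let $\circledast$ denote the statement: every regular space that is hereditarily of countable $\pi$-character is $C$-closed. (1) Assume $2^{\aleph_0}<2^{\aleph_1}$ and $\circledast$. Then every compact (Hausdorff) space of countable tightness is sequential. (2) Assume $\circledast$. If $X$ is a countably compact regular space that is hereditarily of countable $\pi$-character, then every non-isolated point of $X$ is the limit of a non-trivial convergent sequence.
   Context: Regular spaces are assumed to be $T_1$ (hence Hausdorff). A space $X$ has countable $\pi$-character if for every $x\in X$ there is a countable collection $\{U_n:n\in\omega\}$ of non-empty open sets such that every open neighborhood of $x$ contains some $U_n$ (it is not required that $x\in U_n$); it is hereditarily of countable $\pi$-character if every subspace has countable $\pi$-character. $X$ has countable tightness if whenever $A\subseteq X$ and $z\in\mathrm{cl}_X(A)$ there is a countable $A_0\subseteq A$ with $z\in\mathrm{cl}_X(A_0)$. A space is countably compact if every infinite subset has a point of accumulation. A space is $C$-closed if each of its countably compact subsets is closed. A subset $Y$ of $X$ is sequentially closed if it contains the limit of every convergent sequence of points of $Y$; $X$ is sequential if every sequentially closed subset is closed. *)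

(* Defs.v *)
From HB Require Import structures.
From mathcomp Require Import all_boot all_order all_algebra.
From mathcomp Require Import all_classical wochoice topology.

Set Implicit Arguments.
Unset Strict Implicit.
Unset Printing Implicit Defensive.

Local Open Scope classical_set_scope.
Local Open Scope card_scope.

Definition regular_T1_space (X : topologicalType) : Prop :=
  accessible_space X /\ regular_space X.

Definition countable_pi_character (X : topologicalType) : Prop :=
  forall x : X, exists U : nat -> set X,
    (forall n, open (U n) /\ U n !=set0) /\
    (forall V : set X, open_nbhs x V -> exists n, U n `<=` V).

(* [set_type A] carries the subspace topology; the library's [subspace A]
   has all of X as its carrier, the points outside A being isolated. *)
Definition hereditarily_countable_pi_character (X : topologicalType) : Prop :=
  forall A : set X, countable_pi_character (set_type A).

Definition countable_tightness (X : topologicalType) : Prop :=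
  forall (A : set X) (z : X), closure A z ->
    exists A0 : set X, [/\ A0 `<=` A, countable A0 & closure A0 z].

Definition countably_compact (X : topologicalType) : Prop :=
  forall B : set X, infinite_set B -> limit_point B !=set0.

Definition C_closed (X : topologicalType) : Prop :=
  forall A : set X, countably_compact (set_type A) -> closed A.

Definition sequentially_closed (X : topologicalType) (Y : set X) : Prop :=
  forall (u : nat -> X) (x : X),
    (forall n, Y (u n)) -> u @ \oo --> x -> Y x.

Definition sequential_space (X : topologicalType) : Prop :=
  forall Y : set X, sequentially_closed Y -> closed Y.

Definition nontrivial_sequence (X : Type) (u : nat -> X) : Prop :=
  ~ exists c : X, \forall n \near \oo, u n = c.

(* R is the reflexive order of type omega_1 on T: since R is total,
   [~~ R x y] says that y lies strictly below x. *)
Definition omega1_order (T : Type) (R : rel T) : Prop :=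
  [/\ well_order R,
      ~ countable [set: T]
    & forall x : T, countable [set y | ~~ R x y]].

Definition card_lt (T U : Type) (A : set T) (B : set U) : Prop :=
  A #<= B /\ A #!= B.

(* 2^aleph_0 < 2^aleph_1, where [set T] is the power set of T. *)
Definition continuum_lt_power_aleph1 : Prop :=
  exists (T : Type) (R : rel T),
    omega1_order R /\ card_lt [set: set nat] [set: set T].

Definition circledast : Prop :=
  forall X : topologicalType,
    regular_T1_space X -> hereditarily_countable_pi_character X -> C_closed X.

(* Main.v *)
(** Part (2): if [x] is not isolated then X \ {x} is not closed, hence, X being
    C-closed, not countably compact. An infinite subset of X \ {x} without
    accumulation point there has [x] as its only accumulation point in X, so any
    injective sequence in it converges to [x].

    Part (1): by Shapirovskii's theorem a compact space of countable tightness
    is hereditarily of countable pi-character, hence C-closed under the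
    hypothesis. It remains to see that X is sequentially compact, since then
    sequentially closed sets are countably compact. Closing the range of a
    sequence [x] under one choice of cluster point for every sequence yields a
    countably compact, hence closed, set of at most 2^aleph_0 points. If no
    subsequence of [x] converged, every infinite set of indices could be split
    in two whose images lie in disjoint closed sets; iterating this along the
    tree of binary sequences of length omega_1, with pseudo-intersections at
    limits, would give 2^aleph_1 points in the closure of the range. *)

Require Import Defs.
From HB Require Import structures.
From mathcomp Require Import all_boot all_order all_algebra.
From mathcomp Require Import all_classical wochoice topology.

Set Implicit Arguments.
Unset Strict Implicit.
Unset Printing Implicit Defensive.

Local Open Scope classical_set_scope.

(** * Countable families, finite intersections and pseudo-intersections *)

Lemma surjective_sequence (T : Type) (A : set T) :
  countable A -> A !=set0 -> exists e : nat -> T, range e = A.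
Proof.
case/countable_injP => g ginj [a0 Aa0].
have /choice[e eP] (n : nat) : exists y, A y /\ forall a, A a -> g a = n -> y = a.
  case: (pselect (exists a, A a /\ g a = n)) => [[a [Aa <-]]|nA].
    by exists a; split=> // b Ab gb; apply: ginj; rewrite ?inE.
  by exists a0; split=> // a Aa ga; case: nA; exists a.
exists e; rewrite eqEsubset; split=> [_ [n _ <-]|a Aa]; first by case: (eP n).
by exists (g a) => //; exact: (eP _).2.
Qed.

Lemma injective_sequence (T : Type) (A : set T) :
  infinite_set A -> exists2 e : nat -> T, injective e & forall n, A (e n).
Proof.
case/infiniteP/card_leP => f; exists (fun n => val (f (SigSub (mem_setT n)))).
  by move=> m n /val_inj /inj; rewrite !inE => /(_ Logic.I Logic.I) /(congr1 val).
by move=> n; exact: set_valP.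
Qed.

Lemma infinite_nat_ge (A : set nat) (n : nat) :
  infinite_set A -> exists2 k, A k & (n <= k)%N.
Proof.
move=> Ainf; apply: contrapT => nA; apply: Ainf.
apply: (@sub_finite_set _ _ `I_n); last exact: finite_II.
by move=> k Ak; rewrite /= ltnNge; apply/negP => nk; apply: nA; exists k.
Qed.

Lemma infinite_natP (A : set nat) :
  (forall n, exists2 k, A k & (n <= k)%N) -> infinite_set A.
Proof.
move=> Aub /finite_fsetP[D AD].
have [k] := Aub (\max_(i <- finmap.enum_fset D) i).+1.
rewrite AD /= => kD; apply/negP; rewrite -leqNgt.
exact: (@leq_bigmax_seq _ _ xpredT id).
Qed.

(** Inductive form of finite intersections: proofs below peel off one member at a time. *)
Inductive finite_meet (T : Type) (E : set (set T)) : set T -> Prop :=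
| finite_meetT : finite_meet E setT
| finite_meetI U V : E U -> finite_meet E V -> finite_meet E (U `&` V).


Lemma finite_meetS (T : Type) (E E' : set (set T)) :
  E `<=` E' -> finite_meet E `<=` finite_meet E'.
Proof. by move=> EE' U; elim=> [|V W /EE' EV _]; [left|right]. Qed.

Lemma finite_meet1 (T : Type) (E : set (set T)) U : E U -> finite_meet E U.
Proof. by move=> EU; rewrite -[U]setIT; exact: finite_meetI EU (finite_meetT E). Qed.

Lemma finite_meet_setI (T : Type) (E : set (set T)) U V :
  finite_meet E U -> finite_meet E V -> finite_meet E (U `&` V).
Proof.
move=> + EV; elim=> [|W W' EW _ IH]; first by rewrite setTI.
by rewrite -setIA; exact: finite_meetI EW IH.
Qed.

Lemma finite_meet_countable (T : Type) (E : set (set T)) :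
  countable E -> countable (finite_meet E).
Proof.
move=> Ec; apply: (sub_countable _ (finI_from_countable id Ec)).
apply: subset_card_le => U; elim=> [|V W EV _ EW].
  by exists finmap.fset0 => //=; rewrite set_fset0 bigcap_set0.
by apply: finI_fromI => //; exact: (@finI_from1 _ _ _ id).
Qed.

(** Diagonalisation: with [S] enumerated by [e], a number [k n >= n] is taken in the intersection
    [D n] of the first [n] members, so only [k 0, ..., k i] can miss [e i]. *)
Lemma pseudo_intersection (S : set (set nat)) :
  countable S -> (forall U, finite_meet S U -> infinite_set U) ->
  exists2 P, infinite_set P & forall U, S U -> finite_set (P `\` U).
Proof.
move=> Sc Sinf; case: (pselect (S !=set0)) => [S0|/forallNP S0]; last first.
  by exists setT => [|U /S0//]; exact: infinite_nat.
have [e eS] := surjective_sequence Sc S0.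
pose D n := foldr (fun i V => e i `&` V) setT (iota 0 n).
have DE n : finite_meet S (D n).
  rewrite /D; elim: (iota 0 n) => [|i s IH] /=; first by left.
  by right => //; rewrite -eS; exists i.
have De n i : (i < n)%N -> D n `<=` e i.
  rewrite -[X in (X < _)%N]/i => lin; have : i \in iota 0 n by rewrite mem_iota.
  rewrite /D; elim: (iota 0 n) => //= j s IH; rewrite inE => /predU1P[<- k []//|].
  by move=> /IH sub k [_ /sub].
have /choice[k kP] n : exists k, D n k /\ (n <= k)%N.
  by have [k] := infinite_nat_ge n (Sinf _ (DE n)); exists k.
exists (range k).
  by apply: infinite_natP => n; exists (k n); [exists n | case: (kP n)].
move=> U; rewrite -eS => -[i _ <-].
apply: (@sub_finite_set _ _ (k @` `I_i.+1)); last exact/finite_image/finite_II.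
move=> _ [[n _ <-] nek]; exists n => //=; rewrite ltnS leqNgt; apply/negP => lin.
by apply: nek; apply: (De n i) => //; case: (kP n).
Qed.

(** * Well-orders, recursion and bounds of countable sets in omega_1 *)

Section WellOrder.
Context (T : Type) (R : rel T).
Context (woR : well_order R).

(* The strict initial segment of [x]: [below R x y] means y < x. *)
Definition below (x : T) : set T := [set y | ~~ R x y].

Lemma wo_minimum (P : T -> Prop) :
  (exists x, P x) -> exists2 z, P z & forall y, below z y -> ~ P y.
Proof.
move=> [x Px]; have [|z [[Pz zmin] _]] := @woR [pred x | `[< P x >]].
  by exists x; apply/asboolP.
exists z => [|y yz Py]; first exact/asboolP.
by move/negP: yz; apply; apply: zmin; apply/asboolP.
Qed.

Lemma wo_ind (P : T -> Prop) :
  (forall x, (forall y, below x y -> P y) -> P x) -> forall x, P x.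
Proof.
move=> Pind x; apply: contrapT => nPx.
have [|z nPz zmin] := @wo_minimum (fun x => ~ P x); first by exists x.
by apply/nPz/Pind => y /zmin /contrapT.
Qed.

Lemma wo_refl x : R x x.
Proof.
have [|z [[/eqP + zmin] _]] := @woR [pred y | `[< y = x >]].
  by exists x; apply/asboolP.
rewrite eqb_id => /asboolP zx; rewrite -{1}zx.
by apply: zmin; apply/asboolP.
Qed.

Lemma wo_total x y : [\/ below x y, x = y | below y x].
Proof.
have [Rxy|] := boolP (R x y); last by constructor 1.
have [Ryx|] := boolP (R y x); last by constructor 3.
constructor 2.
(* Antisymmetry: [x] and [y] are both minima of the pair, and minima are unique. *)
have [|z [_ zuniq]] := @woR [pred w | `[< w = x \/ w = y >]].
  by exists x; apply/asboolP; left.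
have <- : z = x.
  apply: zuniq; split; first by apply/asboolP; left.
  by move=> w /asboolP[] ->; [exact: wo_refl|].
apply: zuniq; split; first by apply/asboolP; right.
by move=> w /asboolP[] ->; [|exact: wo_refl].
Qed.

Lemma below_irr x : ~ below x x.
Proof. by rewrite /below /= wo_refl. Qed.

Lemma below_trans x y z : below y x -> below z y -> below z x.
Proof.
move=> yx zy.
have [|w wE wmin] := @wo_minimum (fun w => [\/ w = x, w = y | w = z]).
  by exists x; constructor 1.
case: wE wmin => -> wmin.
- have [//|zx|/wmin[]] := wo_total z x; last by constructor 3.
  by case: (wmin y); [rewrite -zx|constructor 2].
- by case: (wmin x yx); constructor 1.
- by case: (wmin y zy); constructor 2.
Qed.

Lemma wo_wf : well_founded (fun x y => below y x).
Proof. by move=> x; elim/wo_ind: x => x IH; constructor. Qed.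

(** The step sees the earlier values only as a set, so two recursions with equal earlier values face
    the same choice; the tree construction relies on this. *)
Lemma wo_rec (Y : Type) (step : T -> set Y -> Y) :
  exists h : T -> Y, forall x, h x = step x (h @` below x).
Proof.
pose F x (r : forall y, below x y -> Y) :=
  step x [set v | exists y (yx : below x y), r y yx = v].
exists (Fix wo_wf (fun=> Y) F) => x; rewrite Fix_eq; last first.
  move=> z f g fg; rewrite /F; congr step; apply/seteqP.
  by split=> v [y [yz <-]]; exists y, yz; rewrite fg.
rewrite {1}/F; congr step; apply/seteqP; split=> [v [y [yx <-]]|v [y yx <-]].
  by exists y.
by exists y, yx.
Qed.

Context (unc : ~ countable [set: T]).
Context (cbelow : forall x, countable (below x)).

(** An unbounded countable [S] would make [T] a countable union of countable closed initial
    segments. *)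
Lemma countable_bounded (S : set T) :
  countable S -> exists x, S `<=` below x.
Proof.
move=> Sc; apply: contrapT => /forallNP nb; apply: unc.
apply: (@sub_countable _ _ _ (\bigcup_(s in S) (below s `|` [set s]))).
  apply: subset_card_le => x _; have /existsNP[s /not_implyP[Ss nsx]] := nb x.
  exists s => //; case: (wo_total s x) => [?|->|//]; [by left|by right].
apply: bigcup_countable => // s _.
have -> : below s `|` [set s] = \bigcup_(b in [set: bool]) if b then below s else [set s].
  apply/seteqP; split=> [x [?|?]|x [[] _ ?]]; [by exists true|by exists false|by left|by right].
apply: bigcup_countable; first exact: countableP.
by case=> _ //; exact: countable1.
Qed.

Lemma wo_unbounded x : exists y, below y x.
Proof.
have [y sy] := countable_bounded (countable1 x).
by exists y; exact: sy.
Qed.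

End WellOrder.

(** * Compactness and regularity *)

Lemma compact_fip (X : topologicalType) (E : set (set X)) :
  compact [set: X] -> (forall U, finite_meet E U -> U !=set0) ->
  exists x, forall U, E U -> closure U x.
Proof.
move=> cX Efip.
have FF : ProperFilter (filter_from (finite_meet E) id).
  apply: filter_from_proper => //; apply: filter_from_filter.
    by exists setT; left.
  by move=> U V EU EV; exists (U `&` V) => //; exact: finite_meet_setI.
have [x [_]] := cX _ FF filterT.
rewrite clusterE => clx; exists x => U EU; apply: clx.
by exists U => //; exact: finite_meet1.
Qed.

Lemma regular_open_nbhs (X : topologicalType) (p : X) (W : set X) :
  regular_space X -> nbhs p W ->
  exists L, [/\ open L, L p & closure L `<=` W].
Proof.
move=> /(_ p) reg /reg[N Np NW]; exists N°; split=> //; first exact: open_interior.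
by apply: subset_trans NW; apply: closureS; exact: interior_subset.
Qed.

Lemma compact_hausdorff_regular (X : topologicalType) :
  compact [set: X] -> hausdorff_space X -> regular_space X.
Proof. by move=> cX hX x; apply: (compact_regular hX cX); exact: filterT. Qed.

(** * Countable pi-character in compact spaces of countable tightness *)

(** For [p] in [A], a countable local pi-base of the subspace [A] at [p], presented by open sets of
    [X]. *)
Definition relative_pi_base (X : topologicalType) (A : set X) (p : X)
    (U : nat -> set X) : Prop :=
  (forall n, open (U n) /\ U n `&` A !=set0) /\
  (forall V, open_nbhs p V -> exists n, U n `&` A `<=` V).

(* One step of the construction of a free sequence: the side [LH.1] contains
   [p], the side [LH.2] meets every trace on [A] cut out by earlier sets. *)
Definition splits (X : topologicalType) (A : set X) (p : X) (E : set (set X))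
    (LH : set X * set X) : Prop :=
  [/\ open LH.1, LH.1 p, open LH.2, closure LH.1 `&` closure LH.2 = set0
    & forall U, finite_meet E U -> U `&` A !=set0 -> U `&` LH.2 `&` A !=set0].

(** The countably many nonempty traces on [A] of finite meets of [E] are no pi-base at [p], so some
    neighbourhood [W] of [p] contains none of them, and each trace meets the complement of any
    closed set inside [W]. *)
Lemma no_pi_base_splits (X : topologicalType) (A : set X) (p : X) :
  regular_space X -> A p -> ~ (exists U, relative_pi_base A p U) ->
  forall E : set (set X), countable E -> E `<=` open ->
  exists LH, splits A p E LH.
Proof.
move=> reg Ap npi E Ec Eo.
pose B := [set U | finite_meet E U /\ U `&` A !=set0].
have [||u uB] := @surjective_sequence _ B.
- apply: sub_countable (finite_meet_countable Ec); apply: subset_card_le.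
  by move=> U [].
- by exists setT; split; [left | exists p].
have BE n : B (u n) by rewrite -uB; exists n.
have [W Wp Wu] : exists2 W, open_nbhs p W & forall n, ~ u n `&` A `<=` W.
  apply: contrapT => nW; apply: npi; exists u; split=> [n|W Wp].
    case: (BE n) => EU UA; split=> //; elim: EU => [|V V' /Eo oV _ oV'].
      exact: openT.
    exact: openI.
  by apply: contrapT => /forallNP nu; apply: nW; exists W.
have [V [oV Vp clV]] := regular_open_nbhs reg (open_nbhs_nbhs Wp).
(* A second shrinking is needed: the closure of the complement of [closure V] may reach the boundary
   of [V], but it misses [V], which contains [closure L]. *)
have [L [oL Lp clL]] := regular_open_nbhs reg (open_nbhs_nbhs (conj oV Vp)).
exists (L, ~` closure V); split=> //=.
- by apply: closed_openC; exact: closed_closure.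
- rewrite -subset0 => x [/clL Vx /closureS clx].
  have /clx : ~` closure V `<=` ~` V by apply: subsetC; exact: subset_closure.
  by have /closure_id <- := open_closedC oV.
- move=> U EU UA; have : B U by [].
  rewrite -uB => -[n _ un]; have /existsNP[x /not_implyP[[ux Ax] nWx]] := Wu n.
  by exists x; rewrite -un; split=> //; split=> // /clV.
Qed.

Lemma closure_sub (X : topologicalType) (A C : set X) :
  closed C -> A `<=` C -> closure A `<=` C.
Proof. by move=> /closure_id CE AC; rewrite CE; exact: closureS. Qed.

(* Shapirovskii's argument: otherwise one finds pairs [(L a, H a)], a < omega_1,
   such that any finite family of sets [L b] (b < a) and [H b] (b >= a) meets
   [A]; compactness then gives a free sequence [x] of length omega_1, with
   [x a] in the closures of all of them, contradicting countable tightness. *)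
Lemma tight_compact_pi_base (T : Type) (R : rel T) (X : topologicalType)
    (A : set X) (p : X) :
  omega1_order R -> compact [set: X] -> hausdorff_space X ->
  countable_tightness X -> A p -> exists U, relative_pi_base A p U.
Proof.
move=> [wo unc cbelow] cX hX tX Ap; apply: contrapT => npi.
have reg := compact_hausdorff_regular cX hX.
have step := no_pi_base_splits reg Ap npi.
pose E (S : set (set X * set X)) := (fst @` S) `|` (snd @` S).
(* The default [(set0, set0)] is never taken: by induction the earlier sets are countably many and
   open, so a split exists. *)
have [h hE] := wo_rec wo (fun _ S => xget (set0, set0) (splits A p (E S))).
have hP a : splits A p (E (h @` below R a)) (h a).
  elim/(wo_ind wo): a => a IH; rewrite [h a]hE; apply: xgetPex; apply: step.
    have imc (f : set X * set X -> set X) : countable (f @` (h @` below R a)).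
      apply: sub_countable (card_image_le _ _) _.
      exact: sub_countable (card_image_le _ _) (cbelow a).
    have -> : E (h @` below R a) =
        \bigcup_(b in [set: bool]) (if b then fst else snd) @` (h @` below R a).
      apply/seteqP; split=> [U [?|?]|U [[] _ ?]];
        by [exists true | exists false | left | right].
    by apply: bigcup_countable => //; exact: countableP.
  by move=> U [] [_ [b /IH[]? ? ? ? _ <-] <-].
pose L a := (h a).1; pose H a := (h a).2.
have LH0 a y : closure (L a) y -> closure (H a) y -> False.
  by move=> Ly Hy; case: (hP a) => _ _ _ + _ => /seteqP[/(_ y (conj Ly Hy))].
pose G a (D : set T) := (L @` below R a) `|` (H @` (D `\` below R a)).
have Gmono a D D' : D `<=` D' -> G a D `<=` G a D'.
  by move=> DD' U [?|[b [/DD' ? ?] <-]]; [left|right; exists b].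
(* Isolate the set [H b] of largest index among those occurring in [U]. *)
have Gsplit a D U : finite_meet (G a D) U ->
    finite_meet (L @` below R a) U \/
    exists b V, [/\ D b, ~ below R a b, finite_meet (G a (below R b)) V
      & V `&` H b `<=` U].
  elim=> [|{}U V [LU|[c [Dc ac] <-]] mV]; first by left; left.
    case=> [mLV|[b [W [Db ab mW WV]]]]; first by left; right.
    right; exists b, (U `&` W); split=> //; first by right => //; left.
    by rewrite -setIA; exact: setIS.
  have mL b W : finite_meet (L @` below R a) W -> finite_meet (G a (below R b)) W.
    by apply: finite_meetS => ? ?; left.
  case=> [/(mL c) mLV|[b [W [Db ab mW WV]]]].
    by right; exists c, V; split=> //; rewrite setIC.
  have [bc|bc|cb] := wo_total wo b c.
  - right; exists b, (H c `&` W); split=> //; last by rewrite -setIA; exact: setIS.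
    by right => //; right; exists c.
  - right; exists b, W; split=> // x [Wx Hx]; rewrite -bc; split=> //; exact: WV.
  - right; exists c, (H b `&` W); split=> //.
      right; first by right; exists b.
      apply: finite_meetS mW; apply: Gmono => d bd; exact: (below_trans wo) bd cb.
    by move=> x [[Hx Wx] Hcx]; split=> //; exact: WV.
pose P a D := forall U, finite_meet (G a D) U -> U `&` A !=set0.
(* A meet of sets [L b] alone contains [p]. Otherwise the set [H b] of largest index is added last:
   all other sets have index below [b], so the split at [b] applies. *)
have Pstep a D : (forall b, D b -> P a (below R b)) -> P a D.
  move=> PD U /Gsplit[mL|[b [V [Db ab mV VU]]]].
    exists p; split=> //; elim: mL => [//|W V [b _ <-] _ Vp].
    by split=> //; case: (hP b).
  have [_ _ _ _ /(_ V) []] := hP b; last 1 first.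
  - by move=> x [/VU Ux Ax]; exists x.
  - apply: finite_meetS mV => W [[c ca <-]|[c [cb _] <-]].
      left; exists (h c) => //; exists c => //.
      have [bc|cb|//] := wo_total wo c b; case: ab; last by rewrite -cb.
      exact: (below_trans wo) bc ca.
    by right; exists (h c) => //; exists c.
  - exact: PD mV.
have PT a : P a [set: T].
  by apply: (Pstep) => b _; elim/(wo_ind wo): b => b IH; exact: Pstep.
have /choice[x xP] a : exists x, forall U, G a [set: T] U -> closure U x.
  by apply: compact_fip => // U /PT[y []]; exists y.
have xL a b : below R a b -> closure (L b) (x a).
  by move=> ab; apply: xP; left; exists b.
have xH a b : ~ below R a b -> closure (H b) (x a).
  by move=> ab; apply: xP; right; exists b.
have [a0 _] : [set: T] !=set0.
  by apply/set0P/eqP => T0; apply: unc; rewrite T0; exact: countable0.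
(* By compactness some [y] lies in the closure of every tail of [x]. *)
pose tail a := x @` [set b | below R b a].
have [y yP] : exists y, forall U, range tail U -> closure U y.
  apply: compact_fip => // U mU.
  suff [a aU] : exists a, tail a `<=` U.
    have [b ab] := wo_unbounded wo unc cbelow a.
    by exists (x b); apply: aU; exists b.
  elim: mU => [|W V [a _ <-] _ [b bV]]; first by exists a0.
  have sub c d : below R d c -> tail d `<=` tail c.
    by move=> cd _ [e de <-]; exists e => //; exact: (below_trans wo) cd de.
  have [ba|eab|ab] := wo_total wo a b.
  - by exists a; rewrite subsetI; split=> //; exact: subset_trans (sub _ _ ba) bV.
  - by exists a; rewrite subsetI; split=> //; rewrite eab.
  - by exists b; rewrite subsetI; split=> //; exact: sub.
have [A0 [A0x A0c yA0]] : exists A0, [/\ A0 `<=` range x, countable A0 & closure A0 y].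
  apply: tX; have := yP _ (imageT tail a0); apply: closureS.
  by move=> _ [b _ <-]; exists b.
have /choice[g gP] z : exists b, A0 z -> x b = z.
  by case: (pselect (A0 z)) => [/A0x[b _ <-]|nz]; [exists b|exists a0].
have [a ga] : exists a, g @` A0 `<=` below R a.
  by apply: (countable_bounded wo) => //; exact: sub_countable (card_image_le _ _) A0c.
(* The tail beyond [a] puts [y] in [closure (L a)], while the points of [A0] have indices below [a]
   and put it in [closure (H a)]. *)
apply: (LH0 a y).
  apply: closure_sub (yP _ (imageT tail a)); first exact: closed_closure.
  by move=> _ [b ab <-]; exact: xL.
apply: closure_sub yA0; first exact: closed_closure.
move=> z A0z; rewrite -(gP z A0z); apply: xH => bb.
apply: (below_irr wo); apply: (below_trans wo) bb; apply: ga.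
by exists z.
Qed.

Lemma tight_compact_hereditary_pi_character (T : Type) (R : rel T)
    (X : topologicalType) :
  omega1_order R -> compact [set: X] -> hausdorff_space X ->
  countable_tightness X -> hereditarily_countable_pi_character X.
Proof.
move=> oR cX hX tX A x.
have [U [UA Ux]] := tight_compact_pi_base oR cX hX tX (set_valP x).
exists (fun n => set_val @^-1` U n); split=> [n|V [[W oW WV] Vx]].
  have [oU [y [Uy Ay]]] := UA n; split; first by exists (U n).
  by exists (SigSub (mem_set Ay)).
have [|n UW] := Ux W; first by split=> //; move: Vx; rewrite -WV.
by exists n => y Uy; rewrite -WV; apply: UW; split=> //; exact: set_valP.
Qed.

(** * Cluster points and the size of closures of sequences *)

Lemma cluster_sequence (X : topologicalType) (u : nat -> X) (y : X) (V : set X)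
    (N : nat) :
  cluster (u @ \oo) y -> nbhs y V -> exists2 n, (N <= n)%N & V (u n).
Proof.
move=> uy Vy; have [||z [[n /= Nn <-] Vn]] := uy (u @` [set n | (N <= n)%N]) V => //.
  by exists N => // n /= Nn; exists n.
by exists n.
Qed.

Lemma countably_compact_subspace (X : topologicalType) (C : set X) :
  (forall u : nat -> X, injective u -> (forall n, C (u n)) ->
    exists2 y, C y & cluster (u @ \oo) y) ->
  countably_compact (set_type C).
Proof.
move=> Ccl B /injective_sequence[u uinj uB].
have [||y Cy uy] := Ccl (set_val \o u); first exact: inj_comp val_inj uinj.
  by move=> n; exact: set_valP.
exists (SigSub (mem_set Cy)) => U [_ [[V oV <-] /= Vy UV]].
(* By injectivity [u] takes the value [y] at most once; beyond that index all terms are distinct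
   from [y], as accumulation requires. *)
have [n0 n0P] : exists n0, forall n, (n0 <= n)%N -> val (u n) != y.
  case: (pselect (exists n, val (u n) = y)) => [[m um]|nu]; last first.
    by exists 0%N => n _; apply/eqP => un; apply: nu; exists n.
  exists m.+1 => n mn; apply/eqP; rewrite -um => /val_inj /uinj nm.
  by rewrite nm ltnn in mn.
have [n /n0P un Vn] := cluster_sequence n0 uy (open_nbhs_nbhs (conj oV Vy)).
by exists (u n); split=> //; exact: UV.
Qed.

(* Well-founded countably branching trees: evaluating a node as a chosen limit
   of its children closes a set under limits of sequences without an iteration
   of length omega_1, and a tree is determined by its set of labelled
   branches, so there are only continuum many. *)
Inductive code : Type := leaf of nat | node of (nat -> code).

Fixpoint encode (c : code) : set (seq nat * nat) :=
  match c with
  | leaf n => [set ([::], n)]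
  | node f => [set pm | exists i p, pm.1 = i :: p /\ encode (f i) (p, pm.2)]
  end.

Lemma encode_inj : injective encode.
Proof.
elim=> [n|f IH] [m|g] //=.
- by move=> /seteqP[/(_ _ erefl)[->]].
- by move=> /seteqP[/(_ _ erefl)[i [p []]]].
- by move=> /seteqP[_ /(_ _ erefl)[i [p []]]].
move=> fg; have {}fg : encode (node f) = encode (node g) := fg; congr node.
apply/funext => i; apply: IH.
apply/seteqP; split=> -[p m] pm.
  have : encode (node f) (i :: p, m) by exists i, p.
  by rewrite fg => -[j [q [/= [<- <-]]]].
have : encode (node g) (i :: p, m) by exists i, p.
by rewrite -fg => -[j [q [/= [<- <-]]]].
Qed.

Fixpoint decode (X : Type) (x : nat -> X) (lim : (nat -> X) -> X) (c : code) : X :=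
  match c with
  | leaf n => x n
  | node f => lim (fun i => decode x lim (f i))
  end.

(** The decoded points contain the range of [x] and a cluster point of each of their sequences, so
    they form a closed set; each is named by a code, hence by a set of naturals. *)
Lemma closure_range_card (X : topologicalType) (x : nat -> X) :
  compact [set: X] -> C_closed X ->
  (closure (range x) #<= [set: set nat])%card.
Proof.
move=> cX ccX.
have /choice[lim limP] (u : nat -> X) : exists y, cluster (u @ \oo) y.
  by have [y []] := cX (u @ \oo) _ filterT; exists y.
pose d := decode x lim.
have dcl : closed (range d).
  apply: ccX; apply: countably_compact_subspace => u _ ud.
  have /choice[c cu] n : exists c, d c = u n by have [c] := ud n; exists c.
  exists (lim u) => //; exists (node c) => //=.
  by congr lim; apply/funext.
have /choice[c cP] y : exists c, closure (range x) y -> d c = y.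
  case: (pselect (closure (range x) y)) => [cly|]; last by exists (leaf 0).
  suff [c _ <-] : range d y by exists c.
  by apply: closure_sub cly => // _ [n _ <-]; exists (leaf n).
apply/pcard_injP.
exists (fun y => [set n | if unpickle n is Some pm then encode (c y) pm else False]).
move=> y z; rewrite !inE => cly clz cyz; rewrite -(cP y) // -(cP z) //; congr d.
apply: encode_inj; apply/funext => pm.
by move/(congr1 (@^~ (pickle pm))): cyz; rewrite /= pickleK.
Qed.

(** * The binary tree of index sets of height omega_1 *)

Definition converges_along (X : topologicalType) (x : nat -> X) (P : set nat)
    (y : X) : Prop :=
  forall V, nbhs y V -> finite_set (P `\` x @^-1` V).

Lemma finite_setD_trans (T : Type) (A B C : set T) :
  finite_set (A `\` B) -> finite_set (B `\` C) -> finite_set (A `\` C).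
Proof.
move=> AB BC; apply: (@sub_finite_set _ _ ((A `\` B) `|` (B `\` C))).
  by move=> z [Az nCz]; case: (pselect (B z)); [right|left].
by rewrite finite_setU.
Qed.

Section Tree.
Context (T : Type) (R : rel T) (X : topologicalType) (x : nat -> X).
Context (oR : omega1_order R).
Context (cX : compact [set: X]).
Context (hX : hausdorff_space X).
Context (nconv :
  forall P, infinite_set P -> ~ exists y, converges_along x P y).

Lemma infinite_filter (P : set nat) : infinite_set P ->
  ProperFilter [set D | finite_set (P `\` x @^-1` D)].
Proof.
move=> Pinf; split.
  by rewrite /= preimage_set0 setD0.
split=> [|D D' /= PD PD'|D D' DD' /=].
- by rewrite /= preimage_setT setDT; exact: finite_set0.
- by rewrite preimage_setI setDIr finite_setU.
- by apply: sub_finite_set; apply: setDS; exact: preimage_subset.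
Qed.

(** The two children of a node whose ancestors carry the index sets in [S]. *)
Definition forks (S : set (set nat)) (PP : set nat * set nat) : Prop :=
  [/\ infinite_set PP.1, infinite_set PP.2,
      forall U, S U -> finite_set (PP.1 `\` U) /\ finite_set (PP.2 `\` U)
    & exists K K', [/\ closed K, closed K', K `&` K' = set0,
        PP.1 `<=` x @^-1` K & PP.2 `<=` x @^-1` K']].

(** Along a pseudo-intersection [P], [x] clusters at some [p] without converging to it: infinitely
    many indices of [P] land near [p], and infinitely many outside some neighbourhood [V]. *)
Lemma forks_exists (S : set (set nat)) :
  countable S -> (forall U, finite_meet S U -> infinite_set U) ->
  exists PP, forks S PP.
Proof.
move=> Sc Sinf; have [P Pinf PS] := pseudo_intersection Sc Sinf.
have reg := compact_hausdorff_regular cX hX.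
have [p [_ clp]] := cX (infinite_filter Pinf) (@filterT _ _ (infinite_filter Pinf)).
have /existsNP[V /not_implyP[Vp PV]] : ~ converges_along x P p.
  by move=> Pp; apply: nconv Pinf _; exists p.
have [L [oL Lp LV]] : exists L, [/\ open L, L p & closure L `<=` V°].
  by apply: regular_open_nbhs => //; exact: nbhs_interior.
exists (P `&` x @^-1` L, P `\` x @^-1` V); split=> //=.
- move=> PL; have [||y [nLy Ly]] := clp (~` L) L => //.
    rewrite /=; apply: sub_finite_set PL => n [Pn] /= /contrapT.
    by split.
  by apply: open_nbhs_nbhs; split.
- move=> U /PS PU; split; apply: sub_finite_set PU => n [[]] //.
- exists (closure L), (~` V°); split=> //.
  + exact: closed_closure.
  + by apply: open_closedC; exact: open_interior.
  + by apply/disjoints_subset; rewrite setCK.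
  + by move=> n [_ /= Ln]; exact: (@subset_closure _ L).
  + by move=> n [_ nV] /interior_subset /nV.
Qed.

(** Each branch [f] carries an almost decreasing tower [A f], and [y f] is a cluster point of [x]
    along it. Where two branches first differ they take opposite children of one fork, whose closed
    sets are disjoint. *)
Lemma tree_injection :
  exists2 y : set T -> X, injective y & forall f, closure (range x) (y f).
Proof.
have [wo unc cbelow] := oR.
pose pick (b : bool) (PP : set nat * set nat) := if b then PP.1 else PP.2.
pose step (f : set T) a S := pick `[< f a >] (xget (set0, set0) (forks S)).
have /choice[A AE] (f : set T) := wo_rec wo (step f).
have Afork f a : forks (A f @` below R a) (xget (set0, set0) (forks (A f @` below R a))) /\
    (infinite_set (A f a) /\ forall b, below R a b -> finite_set (A f a `\` A f b)).
  elim/(wo_ind wo): a => a IH.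
  have forka : forks (A f @` below R a) (xget (set0, set0) (forks (A f @` below R a))).
    apply: (xgetPex (set0, set0)); apply: forks_exists.
      exact: sub_countable (card_image_le _ _) (cbelow a).
    (* Since the tower so far is almost decreasing, its member of largest index in a finite meet is
       almost contained in that meet. *)
    move=> U mU; suff [->|[b ab Ub]] :
        U = setT \/ exists2 b, below R a b & finite_set (A f b `\` U).
    - exact: infinite_nat.
    - move=> Ufin; have [_ [bint _]] := IH b ab; apply: bint.
      apply: (@sub_finite_set _ _ ((A f b `\` U) `|` U)); last by rewrite finite_setU.
      by move=> n An; case: (pselect (U n)); [right|left].
    elim: mU => [|W V [b ab <-] _ IHV]; [by left | right].
    case: IHV => [->|[c ac Vc]].
      by exists b => //; rewrite setIT setDv; exact: finite_set0.
    have fd d : finite_set (A f d `\` A f d) by rewrite setDv; exact: finite_set0.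
    have [cb|bc|bc] := wo_total wo b c.
    + exists b => //; rewrite setDIr finite_setU; split; first exact: fd.
      by apply: finite_setD_trans Vc; apply: (IH b ab).2.2.
    + by exists c => //; rewrite setDIr finite_setU bc.
    + exists c => //; rewrite setDIr finite_setU; split=> //.
      by apply: finite_setD_trans (fd b); apply: (IH c ac).2.2.
  split=> //; rewrite [A f a]AE /step; case: forka => i1 i2 sub _.
  split; first by rewrite /pick; case: ifP.
  move=> b ab; rewrite /pick.
  by have [? ?] := sub _ (imageP (A f) ab); case: ifP.
have [a0 _] : [set: T] !=set0.
  by apply/set0P/eqP => T0; apply: unc; rewrite T0; exact: countable0.
(* The filter consists of the sets containing [x n] for almost all [n] in some [A f a]; [y f] is one
   of its cluster points. *)
have /choice[y yP] f : exists y, forall a K, closed K -> A f a `<=` x @^-1` K -> K y.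
  have FF : ProperFilter [set D | exists a, finite_set (A f a `\` x @^-1` D)].
    split.
      by move=> [a]; rewrite preimage_set0 setD0; exact: (Afork f a).2.1.
    split=> [|D D' [a aD] [b bD']|D D' DD' [a aD]].
    - by exists a0; rewrite preimage_setT setDT; exact: finite_set0.
    - have [ba|ab|ab] := wo_total wo a b.
      + exists a; rewrite preimage_setI setDIr finite_setU; split=> //.
        by apply: finite_setD_trans bD'; exact: (Afork f a).2.2.
      + by exists a; rewrite preimage_setI setDIr finite_setU {2}ab.
      + exists b; rewrite preimage_setI setDIr finite_setU; split=> //.
        by apply: finite_setD_trans aD; exact: (Afork f b).2.2.
    - by exists a; apply: sub_finite_set aD; apply: setDS; exact: preimage_subset.
  have [y [_]] := cX FF (@filterT _ _ FF); rewrite clusterE => cly.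
  exists y => a K /closure_id KE AK; rewrite KE; apply: cly; exists a.
  by rewrite (_ : _ `\` _ = set0) ?finite_set0 // -subset0 => n [/AK].
have sep f g a : (forall b, below R a b -> A f b = A g b) ->
    f a -> ~ g a -> y f <> y g.
  move=> Aeq fa nga yfg.
  have Seq : A f @` below R a = A g @` below R a by exact: eq_imagel.
  have [[_ _ _ [K [K' [cK cK' KK' PK PK']]]] _] := Afork f a.
  have Kf : K (y f).
    by apply: (yP f a) => //; rewrite AE /step asboolT.
  have Kg : K' (y f).
    by rewrite yfg; apply: (yP g a) => //; rewrite AE /step asboolF // -Seq.
  by have : (K `&` K') (y f) by []; rewrite KK'.
exists y => [f g yfg|f]; last first.
  apply: (yP f a0); first exact: closed_closure.
  by move=> n _; apply: subset_closure; exists n.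
apply: contrapT => fg.
have [|a nfg amin] := @wo_minimum _ _ wo (fun a => f a <> g a).
  by apply: contrapT => /forallNP nfg; apply/fg/funext => a; exact: contrapT.
have Aeq b : below R a b -> A f b = A g b.
  elim/(wo_ind wo): b => b IH ab; rewrite !AE /step.
  have -> : f b = g b by apply: contrapT; exact: amin.
  have -> // : A f @` below R b = A g @` below R b.
  by apply: eq_imagel => c bc; apply: IH => //; exact: (below_trans wo) bc ab.
case: (pselect (f a)) => fa; case: (pselect (g a)) => ga.
- by apply: nfg; rewrite propeqE.
- exact: (sep f g a).
- by apply: (sep g f a) => // b /Aeq.
- by apply: nfg; rewrite propeqE.
Qed.

End Tree.

(** * Convergent sequences in C-closed spaces *)

Lemma cvg_cofinite (X : topologicalType) (u : nat -> X) (y : X) :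
  (forall V, nbhs y V -> finite_set (~` (u @^-1` V))) -> u @ \oo --> y.
Proof.
move=> ufin V /ufin Vfin; apply: contrapT => nV; apply: (infinite_natP _ Vfin) => N.
apply: contrapT => nN; apply: nV; exists N => // n /= Nn.
by apply: contrapT => nVn; apply: nN; exists n.
Qed.

Lemma converging_subsequence (T : Type) (R : rel T) (X : topologicalType)
    (x : nat -> X) :
  omega1_order R -> ~ ([set: set T] #<= [set: set nat])%card ->
  compact [set: X] -> hausdorff_space X -> C_closed X ->
  exists2 P, infinite_set P & exists y, converges_along x P y.
Proof.
move=> oR ltc cX hX ccX; apply: contrapT => nconv; apply: ltc.
have [|y yinj ycl] := tree_injection (x := x) oR cX hX.
  by move=> P Pinf Px; apply: nconv; exists P.
have /pcard_injP[g ginj] := closure_range_card x cX ccX.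
by apply/pcard_injP; exists (g \o y) => f f' _ _ /ginj /yinj -> //; exact: mem_set.
Qed.

Lemma sequentially_compact_sequential (X : topologicalType) :
  (forall x : nat -> X,
    exists2 P, infinite_set P & exists y, converges_along x P y) ->
  C_closed X -> sequential_space X.
Proof.
move=> sX ccX Y Yseq; apply: ccX; apply: countably_compact_subspace => u _ uY.
have [P Pinf [y uy]] := sX u; exists y; last first.
  move=> D V [N _ ND] /uy Vfin.
  have [k [Pk Vk] Nk] := infinite_nat_ge N (infinite_setD Pinf Vfin).
  by exists (u k); split; [exact: ND | apply: contrapT => nV; exact: Vk].
(* [k] need be neither increasing nor onto [P]: injectivity pulls the finite exceptional sets back
   to finite sets. *)
have [k kinj kP] := injective_sequence Pinf.
apply: (Yseq (u \o k)) => [n|]; first exact: uY.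
apply: cvg_cofinite => V /uy Vfin.
apply: sub_finite_set (finite_preimage (in2W kinj) Vfin) => n /= nV.
by split; first exact: kP.
Qed.

Lemma C_closed_nontrivial_sequence (X : topologicalType) (x : X) :
  countably_compact X -> C_closed X -> ~ isolated [set: X] x ->
  exists u : nat -> X, nontrivial_sequence u /\ u @ \oo --> x.
Proof.
move=> cX ccX nix.
have [B Binf Blim] : exists2 B : set (set_type (~` [set x])),
    infinite_set B & ~ (limit_point B !=set0).
  apply: contrapT => nB; apply: nix; split; first exact: in_setT.
  exists [set x]; last by rewrite setIT.
  apply: open_nbhs_nbhs; split=> //; rewrite -closedC; apply: ccX => B Binf.
  by apply: contrapT => Blim; apply: nB; exists B.
have [u uinj uB] := injective_sequence Binf.
have vinj : injective (set_val \o u) by exact: inj_comp val_inj uinj.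
exists (set_val \o u); split.
  move=> [z [N _ Nz]]; have /vinj /n_Sn // : (set_val \o u) N = (set_val \o u) N.+1.
  by rewrite (Nz N) ?(Nz N.+1) //=.
apply: cvg_cofinite => V Vx; apply: contrapT => Dinf.
(* Infinitely many terms outside [V] would accumulate at some [z]; as [V] contains none of them, [z]
   is not [x], so [B] would have a limit point in the complement of [x]. *)
set D := ~` _ in Dinf.
have [|z zlim] := cX ((set_val \o u) @` D).
  move=> vfin; apply: Dinf.
  have := finite_preimage (in2W vinj) vfin.
  by apply: sub_finite_set => n Dn; exists n.
have zx : (~` [set x]) z.
  by move=> /= zx; rewrite zx in zlim; have [w [_ [n nV <-]]] := zlim _ Vx.
apply: Blim; exists (SigSub (mem_set zx)) => U [_ [[W oW <-] /= Wz WU]].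
have [w [wz [n _ nw] Ww]] := zlim W (open_nbhs_nbhs (conj oW Wz)).
exists (u n); split=> //; last by apply: WU; move: Ww; rewrite -nw.
by apply: contraNneq wz => un; rewrite -nw /= un.
Qed.

Theorem proposition1p3 :
  (continuum_lt_power_aleph1 -> circledast ->
    forall X : topologicalType,
      compact [set: X] -> hausdorff_space X -> countable_tightness X ->
      sequential_space X)
  /\
  (circledast ->
    forall X : topologicalType,
      countably_compact X -> regular_T1_space X ->
      hereditarily_countable_pi_character X ->
      forall x : X, ~ isolated [set: X] x ->
        exists u : nat -> X, nontrivial_sequence u /\ u @ \oo --> x).
Proof.
split=> [[T [R [oR [le ne]]]] circ X cX hX tX|circ X cX rX pX x].
  have ccX : C_closed X.
    apply: circ; last exact: (tight_compact_hereditary_pi_character oR).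
    split; first exact: hausdorff_accessible.
    exact: compact_hausdorff_regular.
  apply: sequentially_compact_sequential => // x.
  apply: (converging_subsequence x oR) => // ge.
  by move/negP: ne; apply; exact: Cantor_Bernstein.
by apply: C_closed_nontrivial_sequence => //; exact: circ.
Qed.
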